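(* Let $X$ be a space, let $\gamma$ be an ordinal, and let $\eta:X\to[0,\gamma]$ be a quasi-ordinal decomposition of $X$. For each $\alpha\le\gamma$ let $g_\alpha:\mathscr{F}(\eta^{-1}(\alpha))\to\eta^{-1}(\alpha)$ be a continuous selection. Suppose that for each limit ordinal $\lambda\le\gamma$ the selection $g_\lambda$ is $q_\lambda$-maximal, where $q_\lambda\in\eta^{-1}(\lambda)$ is a point such that $\eta^{-1}(\lambda)$ is clopen modulo the point $q_\lambda$. Then the selection $f$ for $\mathscr{F}(X)$ defined by $$f(S)=g_{\min\eta(S)}\left(S\cap\eta^{-1}(\min\eta(S))\right),\qquad S\in\mathscr{F}(X),$$ is continuous.
   Context: All spaces are Hausdorff topological spaces. For a space $X$, $\mathscr{F}(X)$ is the set of all nonempty closed subsets of $X$, endowed with the Vietoris topology, generated by all collections $\langle V_1,\dots,V_n\rangle=\{S\in\mathscr{F}(X): S\subset\bigcup_i V_i\text{ and }S\cap V_i\ne\emptyset\text{ for every }i\}$, where $V_1,\dots,V_n$ is a finite family of open subsets of $X$. A selection for $\mathscr{F}(X)$ is a map $f:\mathscr{F}(X)\to X$ with $f(S)\in S$ for every $S\in\mathscr{F}(X)$; it is continuous if it is continuous with respect to the Vietoris topology. For $p\in X$, a continuous selection $f$ for $\mathscr{F}(X)$ is $p$-maximal if $f(S)=p$ for every $S\in\mathscr{F}(X)$ with $p\in S$. A nonempty closed set $H\subset X$ is clopen modulo a point $q\in H$ if $H\setminus\{q\}$ is open in $X$; $\Delta(X)$ is the family of all $H\in\mathscr{F}(X)$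 that are clopen modulo some point of $H$. The set $[0,\gamma]$ of all ordinals $\alpha\le\gamma$ carries the order topology. A quasi-ordinal decomposition of $X$ is a continuous map $\eta:X\to[0,\gamma]$ such that $\eta^{-1}(\alpha)\in\Delta(X)$ for every $\alpha\le\gamma$ (in particular every fibre is nonempty). Limit ordinals are nonzero. *)

(* Defs.v *)
From HB Require Import structures.
From mathcomp Require Import all_boot all_order all_algebra.
From mathcomp Require Import all_classical wochoice topology.

Set Implicit Arguments.
Unset Strict Implicit.
Unset Printing Implicit Defensive.

Import Order.TTheory.

Local Open Scope classical_set_scope.
Local Open Scope order_scope.

Definition hyperspace (X : topologicalType) : Type :=
  {S : set X | closed S /\ S !=set0}.

Definition vietoris_set (X : topologicalType) (n : nat) (V : 'I_n -> set X) :
    set (hyperspace X) :=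
  [set S | sval S `<=` \bigcup_i V i /\ forall i, sval S `&` V i !=set0].

HB.instance Definition _ (X : topologicalType) := gen_eqMixin (hyperspace X).
HB.instance Definition _ (X : topologicalType) :=
  gen_choiceMixin (hyperspace X).
HB.instance Definition _ (X : topologicalType) :=
  @isSubBaseTopological.Build (hyperspace X) (set (hyperspace X))
    [set B | exists (n : nat) (V : 'I_n -> set X),
       (forall i, open (V i)) /\ B = vietoris_set V]
    id.

Definition selection (X : topologicalType) (f : hyperspace X -> X) : Prop :=
  forall S, sval S (f S).

Definition continuous_selection (X : topologicalType)
    (f : hyperspace X -> X) : Prop :=
  selection f /\ continuous f.

Definition maximal_selection (X : topologicalType) (p : X)
    (f : hyperspace X -> X) : Prop :=
  continuous_selection f /\ forall S, sval S p -> f S = p.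

Definition clopen_modulo (X : topologicalType) (H : set X) (q : X) : Prop :=
  [/\ closed H, H q & open (H `\ q)].

Definition Delta (X : topologicalType) : set (set X) :=
  [set H | exists q, clopen_modulo H q].

(* Ordinals are taken up to isomorphism: the intervals [0,gamma] are exactly
   the well-ordered sets with a largest element gamma. *)
Definition ordinal_interval d (T : orderType d) (gamma : T) : Prop :=
  well_order (<=%O : rel T) /\ forall a : T, a <= gamma.

Definition successor_ordinal d (T : orderType d) (a : T) : Prop :=
  exists b : T, b < a /\ forall c : T, b < c -> a <= c.

Definition limit_ordinal d (T : orderType d) (a : T) : Prop :=
  (exists b : T, b < a) /\ ~ successor_ordinal a.

Definition fiber (X Y : Type) (eta : X -> Y) (y : Y) : set X :=
  eta @^-1` [set y].

Definition quasi_ordinal_decomposition d (X : topologicalType)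
    (T : orderTopologicalType d) (eta : X -> T) : Prop :=
  continuous eta /\ forall a : T, Delta (fiber eta a).

Lemma well_order_min d (T : orderType d) (A : set T) :
  well_order (<=%O : rel T) -> A !=set0 -> exists a, A a /\ lbound A a.
Proof.
move=> wo [x Ax]; have [|a [[aA lba] _]] := wo [in A].
  by exists x; rewrite inE.
exists a; split; first by move: aA; rewrite !inE.
by move=> y Ay; apply: lba; rewrite inE.
Qed.

Section glued_selection.
Context d (X : topologicalType) (T : orderTopologicalType d) (gamma : T).
Hypothesis ord : ordinal_interval gamma.
Variable eta : X -> T.

Lemma image_hyperspace_min (S : hyperspace X) :
  exists a, (eta @` sval S) a /\ lbound (eta @` sval S) a.
Proof.
apply: (well_order_min ord.1); case: S => S [_ [x Sx]] /=.
by exists (eta x), x.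
Qed.

Definition min_image (S : hyperspace X) : T :=
  sval (cid (image_hyperspace_min S)).

(* The set S `&` fiber eta (min_image S), seen in the subspace. *)
Definition min_trace_set (S : hyperspace X) :
    set (fiber eta (min_image S)) :=
  set_val @^-1` sval S.
Arguments min_trace_set S : clear implicits.

Lemma min_trace_subproof (S : hyperspace X) :
  closed (min_trace_set S) /\ min_trace_set S !=set0.
Proof.
split.
  apply: preimage_closed; last by case: S => S [].
  move=> x _.
  exact: (@initial_continuous (fiber eta (min_image S)) X set_val).
rewrite /min_trace_set /min_image.
case: cid => a /= [[x Sx xa] _].
have xf : x \in fiber eta a by rewrite inE.
by exists (exist _ x xf).
Qed.

Definition min_trace (S : hyperspace X) :
    hyperspace (fiber eta (min_image S)) :=
  exist _ (min_trace_set S) (min_trace_subproof S).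

Definition glued_selection
    (g : forall a : T, hyperspace (fiber eta a) -> fiber eta a)
    (S : hyperspace X) : X :=
  set_val (g (min_image S) (min_trace S)).

End glued_selection.

(* Main.v *)
(* Fix [S] with [a = min eta(S)]. Since [0, a] is clopen, every [S'] near [S]
   has [min eta(S') <= a], and among those with equality the trace on the fiber
   of [a] depends continuously on [S'], hence so does [f(S')]. It remains to
   control the [S'] with smaller minimum. If [a] is not a limit, [eta >= a] is
   open and there are none. If [a] is a limit, [eta >= a] deprived of [q_a] is
   open: there are none either when [q_a] is not in [S]; otherwise
   [f(S) = q_a] by maximality, and if [S'] lies in the union of this open set
   and a neighborhood [U] of [q_a], its points below [a], among them [f(S')],
   are in [U]. *)

Require Import Defs.
From mathcomp Require Import all_boot all_order all_algebra.
From mathcomp Require Import finmap.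
From mathcomp Require Import all_classical wochoice topology.

Set Implicit Arguments.
Unset Strict Implicit.
Unset Printing Implicit Defensive.

Import Order.TTheory.
Local Open Scope classical_set_scope.
Local Open Scope order_scope.

Lemma near_vietoris_set (X : topologicalType) (S : hyperspace X) (n : nat)
    (V : 'I_n -> set X) :
  (forall i, open (V i)) -> vietoris_set V S -> nbhs S (vietoris_set V).
Proof.
move=> oV VS; rewrite nbhsE; exists (vietoris_set V) => //; split=> //.
exists [set vietoris_set V]; last by rewrite bigcup_set1.
move=> _ ->; exists [fset (vietoris_set V)]%fset.
  by move=> A /fset1P ->; rewrite inE; exists n, V.
by rewrite set_fset1 bigcap_set1.
Qed.

Lemma near_sub_open (X : topologicalType) (S : hyperspace X) (U : set X) :
  open U -> sval S `<=` U -> \forall S' \near S, sval S' `<=` U.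
Proof.
move=> oU SU; have := @near_vietoris_set X S 1 (fun=> U) (fun=> oU).
case: (svalP S) => _ [x Sx] nbS; apply: filterS (nbS _).
  by move=> S' [S'U _] y /S'U[].
split=> [y /SU Uy|_]; first by exists ord0.
by exists x; split=> //; exact: SU.
Qed.

Lemma near_meet_open (X : topologicalType) (S : hyperspace X) (U : set X) :
  open U -> sval S `&` U !=set0 -> \forall S' \near S, sval S' `&` U !=set0.
Proof.
(* The second member [setT] makes the covering condition of [vietoris_set V] vacuous, so only the
   meeting condition for [U] remains. *)
move=> oU SU; pose V (i : 'I_2) := if i == ord0 then U else setT.
have oV i : open (V i) by rewrite /V; case: ifP => // _; exact: openT.
apply: filterS (near_vietoris_set oV _); first by move=> S' [_ /(_ ord0)].
split=> [y _|i]; first by exists ord_max.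
rewrite /V; case: ifP => // _.
by case: SU => x [Sx _]; exists x.
Qed.

(** A filter is closed under finite intersections, so the subbase suffices. The filter is arbitrary
    because [near_trace] needs one that is not presented as the image of [nbhs S] under a map. *)
Lemma vietoris_cvg (X : topologicalType) (F : set_system (hyperspace X))
    (K : hyperspace X) :
  Filter F ->
  (forall (n : nat) (V : 'I_n -> set X), (forall i, open (V i)) ->
     vietoris_set V K -> F (vietoris_set V)) ->
  F --> K.
Proof.
move=> FF FV N; rewrite nbhsE => -[B [[E EB <-] [A EA AK]] BN].
apply: filterS BN _; apply: filterS (bigcup_sup EA) _.
have [G GV AE] := EB _ EA; rewrite -AE in AK *.
apply: filter_bigI => W GW; have := AK _ GW.
by have := GV _ GW; rewrite inE => -[n [V [oV ->]]]; exact: FV.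
Qed.

Section glued.
Context {X : topologicalType} {d : Order.disp_t} {T : orderTopologicalType d}.
Context {gamma : T} (ord : ordinal_interval gamma) {eta : X -> T}.
Context (eta_cont : continuous eta).
Context (g : forall a : T, hyperspace (fiber eta a) -> fiber eta a).

Local Notation f := (glued_selection ord (@g)).
Local Notation mu := (min_image ord eta).

Lemma min_imageP (S : hyperspace X) :
  (eta @` sval S) (mu S) /\ lbound (eta @` sval S) (mu S).
Proof. exact: svalP (cid (image_hyperspace_min ord eta S)). Qed.

Lemma min_image_le (S : hyperspace X) (x : X) : sval S x -> mu S <= eta x.
Proof. by move=> Sx; apply: (min_imageP S).2; exists x. Qed.

Lemma eta_set_val (a : T) (y : fiber eta a) : eta (set_val y) = a.
Proof. by have := set_valP y. Qed.

(** The type of [min_trace] depends on [mu S]. Naming the trace only through its underlying set lets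
    traces of different [S] with the same minimum live in one hyperspace, without transports. *)
Lemma glued_selectionE (S : hyperspace X) (a : T) : mu S = a ->
  exists2 K : hyperspace (fiber eta a),
    sval K = set_val @^-1` sval S & f S = set_val (g K).
Proof. by move=> <-; exists (min_trace ord eta S). Qed.

Lemma eta_glued (S : hyperspace X) : eta (f S) = mu S.
Proof.
by have [K _ ->] := glued_selectionE (erefl (mu S)); exact: eta_set_val.
Qed.

(** Either [a] is least and the set is all of [X], or [a] is the successor of some [c] and the set
    is the preimage of the open ray above [c]. *)
Lemma open_ge (a : T) : ~ limit_ordinal a -> open [set x | a <= eta x].
Proof.
move=> nlim; have [[b ba]|nob] := pselect (exists b : T, b < a); last first.
  rewrite (_ : mkset _ = setT); first exact: openT.
  apply/seteqP; split=> // x _ /=; rewrite leNgt; apply/negP => xa.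
  by apply: nob; exists (eta x).
have [[c [ca cP]]|nsucc] := pselect (successor_ordinal a); last first.
  by case: nlim; split=> //; exists b.
rewrite (_ : mkset _ = eta @^-1` `]c, +oo[).
  by apply: open_comp (rray_open c) => x _; exact: eta_cont.
apply/seteqP; split=> x /=; rewrite in_itv /= andbT; last exact: cP.
exact: lt_le_trans.
Qed.

Lemma open_gt (a : T) : open [set x | a < eta x].
Proof.
rewrite (_ : mkset _ = eta @^-1` `]a, +oo[).
  by apply: open_comp (rray_open a) => x _; exact: eta_cont.
by apply/seteqP; split=> x /=; rewrite in_itv /= andbT.
Qed.

(* [0, a] is either the whole interval or [0, a + 1). *)
Lemma open_le (a : T) : open [set x | eta x <= a].
Proof.
have [[c ac]|noc] := pselect (exists c : T, a < c); last first.
  rewrite (_ : mkset _ = setT); first exact: openT.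
  apply/seteqP; split=> // x _ /=; rewrite leNgt; apply/negP => xa.
  by apply: noc; exists (eta x).
have [s [/= als slb]] : exists s, [set c | a < c] s /\ lbound [set c | a < c] s.
  by apply: well_order_min ord.1 _; exists c.
rewrite (_ : mkset _ = eta @^-1` `]-oo, s[).
  by apply: open_comp (lray_open s) => x _; exact: eta_cont.
apply/seteqP; split=> x /=; rewrite in_itv /=.
  by move=> xa; exact: le_lt_trans als.
by move=> xs; rewrite leNgt; apply/negP => /slb; rewrite leNgt xs.
Qed.

(* [K] is the trace of [S]. An open set of the fiber is only the trace of some
   open [V'] of [X]; cutting [V'] with the open set [eta <= a] ensures that an
   [S'] with minimum [a] which meets it does so inside the fiber. *)
Lemma near_trace (S : hyperspace X) (a : T) (K : hyperspace (fiber eta a))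
    (N : set (hyperspace (fiber eta a))) :
  mu S = a -> sval K = set_val @^-1` sval S -> nbhs K N ->
  \forall S' \near S, mu S' = a ->
    forall K' : hyperspace (fiber eta a),
      sval K' = set_val @^-1` sval S' -> N K'.
Proof.
(* [F] plays the role of the limit of traces along [nbhs S]: an [S'] with another minimum is
   ignored, as its trace on this fiber may be empty. *)
move=> Sa KS; pose F : set_system (hyperspace (fiber eta a)) :=
  fun N => \forall S' \near S, mu S' = a ->
    forall K' : hyperspace (fiber eta a),
      sval K' = set_val @^-1` sval S' -> N K'.
suff FK : F --> K by exact: (FK N).
have FF : Filter F.
  split; rewrite /F; first exact: (@nearW _ (nbhs S)).
    move=> A B; apply: filterS2 => S' AS' BS' S'a K' K'S'.
    by split; [exact: AS'|exact: BS'].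
  by move=> A B AB; apply: filterS => S' AS' S'a K' K'S'; exact/AB/AS'.
apply: vietoris_cvg => n V oV [KV KmV].
have /choice[V' V'P] i : exists V' : set X, open V' /\ set_val @^-1` V' = V i.
  by have [V' oV' <-] := oV i; exists V'.
pose O i := V' i `&` [set x | eta x <= a].
have oO i : open (O i) by apply: openI (open_le a); exact: (V'P i).1.
have inO i (y : fiber eta a) : V i y <-> O i (set_val y).
  have ya : eta (set_val y) <= a by rewrite eta_set_val.
  by rewrite -(V'P i).2; split=> [|[]].
have fibP x : eta x = a -> exists y : fiber eta a, set_val y = x.
  by move=> xa; exists (SigSub (mem_set xa : x \in fiber eta a)).
rewrite /F.
have SO : \forall S' \near S, forall i, sval S' `&` O i !=set0.
  apply: (@filter_forall _ _ _ (nbhs S)) => i; apply: near_meet_open => //.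
  have [y [Ky Vy]] := KmV i; exists (set_val y); split; last exact/inO.
  by move: Ky; rewrite KS.
(* The part [a < eta x] absorbs the points of [S] outside the fiber; being disjoint from the fiber,
   it puts no point in the trace. *)
have SU : \forall S' \near S,
    sval S' `<=` (\bigcup_i O i) `|` [set x | a < eta x].
  apply: near_sub_open.
    by apply: openU (open_gt a); apply: bigcup_open => i _.
  move=> x Sx; have := min_image_le Sx; rewrite Sa le_eqVlt.
  case/orP=> [/eqP/esym/fibP[y yx]|]; last by right.
  left; have [|i _ Viy] := KV y; first by rewrite KS /= yx.
  by exists i => //; rewrite -yx; exact/inO.
near=> S' => S'a K' K'S'; split=> [y|i].
  rewrite K'S' /= => S'y.
  have [] := near SU S' _ _ S'y => //; last by rewrite /mkset eta_set_val ltxx.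
  by case=> i _ Oy; exists i => //; exact/inO.
have [//|x [S'x Ox]] := near SO S' _ i.
have [y yx] : exists y : fiber eta a, set_val y = x.
  apply: fibP; apply/le_anti; rewrite Ox.2 -S'a; exact: min_image_le.
by exists y; split; [rewrite K'S' /= yx|apply/inO; rewrite yx].
Unshelve. all: by end_near.
Qed.

(** Reduces the limit and non-limit cases to finding [G]. For [S'] inside [G] with smaller minimum,
    [f S'] lies in [G] and [eta (f S')] is that minimum, hence [U (f S')]. *)
Lemma glued_selection_cvg (S : hyperspace X) (U : set X) :
  (forall a, continuous_selection (@g a)) -> nbhs (f S) U ->
  (exists G : set X, [/\ open G, sval S `<=` G &
     forall x, G x -> eta x < mu S -> U x]) ->
  nbhs S (f @^-1` U).
Proof.
move=> gc fU [G [oG SG GU]].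
have [K KS fS] := glued_selectionE (erefl (mu S)).
have UK : nbhs K [set K' | U (set_val (g K'))].
  apply: ((gc (mu S)).2 K (set_val @^-1` U)).
  by apply: (@initial_continuous (fiber eta (mu S)) X set_val); rewrite -fS.
have S_trace := near_trace erefl KS UK.
have S_G := near_sub_open oG SG.
have S_le : \forall S' \near S, sval S' `&` [set x | eta x <= mu S] !=set0.
  apply: near_meet_open; first exact: open_le.
  by have [[x Sx xS] _] := min_imageP S; exists x; split=> //=; rewrite xS.
near=> S'; rewrite /=.
have [//|x [S'x xS]] := near S_le S' _.
have := le_trans (min_image_le S'x) xS; rewrite le_eqVlt.
case/orP => [/eqP S'S|S'S].
  have [K' K'S' ->] := glued_selectionE S'S.
  exact: (near S_trace S' _ S'S K' K'S').
apply: GU; last by rewrite eta_glued.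
apply: (near S_G S') => //.
have [K' K'S' ->] := glued_selectionE (erefl (mu S')).
by have := (gc (mu S')).1 K'; rewrite K'S'.
Unshelve. all: by end_near.
Qed.

End glued.

Theorem theorem2p2 (X : topologicalType) (hX : hausdorff_space X)
    (d : Order.disp_t) (T : orderTopologicalType d) (gamma : T)
    (hgamma : ordinal_interval gamma)
    (eta : X -> T) (heta : quasi_ordinal_decomposition eta)
    (g : forall a : T, hyperspace (fiber eta a) -> fiber eta a)
    (hg : forall a : T, continuous_selection (g a))
    (hlim : forall a : T, limit_ordinal a ->
       exists q : fiber eta a,
         clopen_modulo (fiber eta a) (set_val q) /\
         maximal_selection q (g a)) :
  continuous_selection (glued_selection hgamma g).
Proof.
have eta_cont := heta.1; split=> [S|S U fU].
  have [K KS ->] := glued_selectionE g (erefl (min_image hgamma eta S)).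
  by have := (hg _).1 K; rewrite KS.
apply: glued_selection_cvg => //.
set a := min_image hgamma eta S.
have aS x : sval S x -> a <= eta x by exact: min_image_le.
have [/hlim[q [[_ _ oHq] [_ gq]]]|/(open_ge eta_cont) oa] :=
    pselect (limit_ordinal a); last first.
  (* No point of this [G] lies below [a], so the condition on [U] is vacuous. *)
  by exists [set x | a <= eta x]; split=> // x /= ax; rewrite ltNge ax.
pose B := (fiber eta a `\ set_val q) `|` [set x | a < eta x].
have oB : open B by apply: openU => //; exact: open_gt.
have SB x : sval S x -> x <> set_val q -> B x.
  move=> Sx xq; have := aS _ Sx; rewrite le_eqVlt.
  by case/orP => [/eqP ax|]; [left|right].
have Ba x : B x -> eta x < a -> U x.
  by case=> [[/= -> _]|/= /lt_trans ax /ax]; rewrite ltxx.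
have [Sq|nSq] := pselect (sval S (set_val q)); last first.
  by exists B; split=> // x Sx; apply: SB => // xq; rewrite xq in Sx.
have fSq : glued_selection hgamma g S = set_val q.
  have [K KS ->] := glued_selectionE g (erefl a).
  by rewrite gq // KS.
move: fU; rewrite fSq nbhsE => -[O [oO Oq] OU].
exists (O `|` B); split; first exact: openU.
  move=> x Sx; have [->|xq] := pselect (x = set_val q); first by left.
  by right; exact: SB.
by move=> x [/OU //|]; exact: Ba.
Qed.
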